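(* Let $G$ be a finite, simple, connected graph. Then: (i) ${\rm mdim}(S(G)) \le {\rm mdim}(G)$; (ii) $\phi(G) \ge \max\{\dim(G), {\rm edim}(G)\}$.
   Context: For a connected graph $H$, $d_H$ is the usual distance; for a vertex $v$ and an edge $e=ww'$, $d_H(e,v)=\min\{d_H(w,v),d_H(w',v)\}$. A vertex $v$ resolves two elements $x,y\in V(H)\cup E(H)$ if $d_H(x,v)\ne d_H(y,v)$. A set $S\subseteq V(H)$ is a resolving set (resp. edge resolving set, mixed resolving set) if every two distinct vertices (resp. every two distinct edges, every two distinct elements of $V(H)\cup E(H)$) are resolved by some vertex of $S$. $\dim(H)$, ${\rm edim}(H)$, ${\rm mdim}(H)$ denote the minimum cardinalities of a resolving set, an edge resolving set, and a mixed resolving set, respectively (the metric, edge metric, and mixed metric dimension); a metric basis is a resolving set of cardinality $\dim(H)$. The subdivision graph $S(G)$ is obtained from $G$ by subdividing every edge once; for $e\in E(G)$, $v_e$ denotes the new vertex on $e$ (a subdivision vertex). For a metric basis $X$ of $S(G)$, let $\phi(X)=\{u\in V(G): u\in X \text{ or } u \text{ is adjacent in } S(G) \text{ to a subdivision vertex belonging to } X\}$, and let $\phi(G)=\min\{|\phi(X)| : X \text{ is a metric basis of } S(G)\}$. *)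

(* Defs.v *)
From mathcomp Require Import all_boot.

Set Implicit Arguments.
Unset Strict Implicit.
Unset Printing Implicit Defensive.

Record sgraph := SGraph {
  vertex :> finType;
  adj : rel vertex;
  adj_sym : symmetric adj;
  adj_irrefl : irreflexive adj
}.

Definition connected (G : sgraph) : Prop :=
  0 < #|G| /\ forall x y : G, connect (@adj G) x y.

Definition edges (G : sgraph) : {set {set G}} :=
  [set e : {set G} | [exists x, exists y, adj x y && (e == [set x; y])]].

Definition edge (G : sgraph) := {e : {set G} | e \in edges G}.

Section Distance.

Variable G : sgraph.
Implicit Types (x y v : G) (S : {set G}).

Definition walk_of_length x y (n : nat) : bool :=
  [exists p : n.-tuple G, path (@adj G) x p && (last x p == y)].

(* The value is #|G| when there is no walk, which cannot happen in a connected
   graph; shortest walks have length < #|G|. *)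
Definition dist x y : nat := find (walk_of_length x y) (iota 0 #|G|).

(* The default value #|G| of the minimum is an upper bound of all distances. *)
Definition edist (e : edge G) v : nat :=
  \big[minn/#|G|]_(w in val e) dist w v.

Definition eltdist (a : G + edge G) v : nat :=
  match a with inl x => dist x v | inr e => edist e v end.

Definition resolves v (a b : G + edge G) : bool := eltdist a v != eltdist b v.

Definition resolving S : bool :=
  [forall x : G, forall y : G, (x != y) ==>
    [exists v in S, resolves v (inl x) (inl y)]].

Definition edge_resolving S : bool :=
  [forall e : edge G, forall f : edge G, (e != f) ==>
    [exists v in S, resolves v (inr e) (inr f)]].

Definition mixed_resolving S : bool :=
  [forall a : G + edge G, forall b : G + edge G, (a != b) ==>
    [exists v in S, resolves v a b]].

(* The default #|G| is harmless: the set of all vertices is resolving in each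
   of the three senses (see resolvingT and its variants below). *)
Definition dim : nat := \big[minn/#|G|]_(S : {set G} | resolving S) #|S|.
Definition edim : nat := \big[minn/#|G|]_(S : {set G} | edge_resolving S) #|S|.
Definition mdim : nat := \big[minn/#|G|]_(S : {set G} | mixed_resolving S) #|S|.

Definition metric_basis S : bool := resolving S && (#|S| == dim).

End Distance.

Arguments dim : clear implicits.
Arguments edim : clear implicits.
Arguments mdim : clear implicits.

Section Subdivision.

Variable G : sgraph.

(* inl u is the original vertex u, inr e is the subdivision vertex v_e. *)
Definition subdiv_adj : rel (G + edge G) := fun a b =>
  match a, b with
  | inl u, inr e | inr e, inl u => u \in val e
  | _, _ => false
  end.

Lemma subdiv_adj_sym : symmetric subdiv_adj.
Proof. by move=> [u|e] [w|f]. Qed.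

Lemma subdiv_adj_irrefl : irreflexive subdiv_adj.
Proof. by move=> [u|e]. Qed.

Definition subdiv : sgraph := SGraph subdiv_adj_sym subdiv_adj_irrefl.

Definition phi_set (X : {set subdiv}) : {set G} :=
  [set u : G | ((inl u : subdiv) \in X)
    || [exists e : edge G, ((inr e : subdiv) \in X) &&
                           adj (inl u : subdiv) (inr e : subdiv)]].

(* Every phi_set X has at most #|G| elements, and metric bases exist. *)
Definition phi : nat :=
  \big[minn/#|G|]_(X : {set subdiv} | metric_basis X) #|phi_set X|.

End Subdivision.

Lemma distP (G : sgraph) (x y : G) : connect (@adj G) x y ->
  (exists p, [/\ path (@adj G) x p, last x p = y & size p = dist x y]) /\
  (forall p, path (@adj G) x p -> last x p = y -> dist x y <= size p).
Proof.
have walkP q : path (@adj G) x q -> last x q = y -> walk_of_length x y (size q).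
  by move=> pq lq; apply/existsP; exists (in_tuple q); rewrite /= pq lq eqxx.
move=> /connectP[p0 /shortenP[p pp up _] /esym lp].
have sp : size p < #|G| by rewrite -[(size p).+1]/(size (x :: p)) -(card_uniqP up) max_card.
have hasw : has (walk_of_length x y) (iota 0 #|G|).
  by apply/hasP; exists (size p); rewrite ?mem_iota ?walkP.
have ld : dist x y < #|G| by move: hasw; rewrite has_find size_iota.
split.
  have := nth_find 0 hasw; rewrite -/(dist x y) nth_iota // add0n.
  by case/existsP=> q /andP[pq /eqP lq]; exists q; rewrite size_tuple.
move=> q pq lq; rewrite leqNgt; apply/negP=> lt_q.
have := before_find 0 lt_q.
by rewrite nth_iota ?(ltn_trans lt_q) // add0n walkP.
Qed.

Lemma bigminnP (I : finType) (P : pred I) (F : I -> nat) (m : nat) (i0 : I) :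
  P i0 -> F i0 <= m ->
  (exists2 i, P i & F i = \big[minn/m]_(i | P i) F i) /\
  (forall i, P i -> \big[minn/m]_(i | P i) F i <= F i).
Proof.
move=> Pi0 Fi0.
have lb i : P i -> \big[minn/m]_(i | P i) F i <= F i.
  move=> Pi; have: i \in index_enum I by rewrite mem_index_enum.
  elim: (index_enum I) => // j s IHs; rewrite inE big_cons => /predU1P[<-|/IHs].
    by rewrite Pi geq_minl.
  by case: ifP => // _; apply: leq_trans; apply: geq_minr.
split=> //.
have [i1 Pi1 min1] := arg_minnP F Pi0.
exists i1 => //; apply/eqP; rewrite eqn_leq lb // andbT.
elim/big_ind: _ => //; last by move=> a b ha hb; rewrite leq_min ha hb.
exact: leq_trans (min1 _ Pi0) Fi0.
Qed.

Section FullSet.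

Variable G : sgraph.

Lemma card_gt0 (x : G) : 0 < #|G|.
Proof. by apply/card_gt0P; exists x. Qed.

Lemma dist_eq0 (x y : G) : (dist x y == 0) = (x == y).
Proof.
rewrite /dist; case: #|G| (card_gt0 x) => // n _ /=.
suff ->: walk_of_length x y 0 = (x == y) by case: (x == y).
apply/existsP/idP => [[p]|xy]; first by rewrite tuple0.
by exists [tuple].
Qed.

Lemma edist_eq0 (e : edge G) (v : G) : (edist e v == 0) = (v \in val e).
Proof.
apply/idP/idP => [|ve].
  apply: contraLR => nv; rewrite -lt0n /edist.
  elim/big_ind: _ => [|a b a0 b0|w we]; first exact: card_gt0 v.
    by rewrite leq_min a0.
  by rewrite lt0n dist_eq0; apply: contraNneq nv => <-.
have d0 : dist v v = 0 by apply/eqP; rewrite dist_eq0.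
have [] := @bigminnP _ (mem (val e)) (fun w => dist w v) #|G| v ve.
  by rewrite d0.
by move=> _ /(_ v ve); rewrite d0 leqn0.
Qed.

Lemma mixed_resolvingT : mixed_resolving [set: G].
Proof.
have ne v a b : (eltdist a v == 0) != (eltdist b v == 0) ->
    [exists v in [set: G], resolves v a b].
  by move=> h; apply/existsP; exists v; rewrite inE /=; apply: contraNneq h => ->.
have other (x : G) (e : edge G) : exists2 w, w \in val e & x != w.
  case: e => e /=; rewrite inE => /existsP[y /existsP[z /andP[yz /eqP->]]].
  have [->|] := eqVneq x y; last by exists y; rewrite // !inE eqxx.
  exists z; first by rewrite !inE eqxx orbT.
  by apply: contraTneq yz => ->; rewrite adj_irrefl.
apply/forallP=> a; apply/forallP=> b; apply/implyP; case: a b => [x|e] [y|f] ab.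
- have yx : (y == x) = false by apply: contraNF ab => /eqP->.
  by apply: (ne x); rewrite /= !dist_eq0 eqxx yx.
- have [w wf wx] := other x f.
  by apply: (ne w); rewrite /= dist_eq0 edist_eq0 wf (negPf wx).
- have [w wf wx] := other y e.
  by apply: (ne w); rewrite /= dist_eq0 edist_eq0 wf (negPf wx).
have [v] : exists v, (v \in val e) != (v \in val f).
  apply/existsP; apply: contraNT ab => /existsPn h.
  by apply/eqP; congr inr; apply/val_inj/setP=> v; apply/eqP/negPn/h.
by move=> h; apply: (ne v); rewrite /= !edist_eq0.
Qed.

Lemma resolvingT : resolving [set: G].
Proof.
apply/forallP=> x; apply/forallP=> y; apply/implyP=> xy.
by have /forallP/(_ (inl x))/forallP/(_ (inl y))/implyP := mixed_resolvingT; apply.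
Qed.

Lemma edge_resolvingT : edge_resolving [set: G].
Proof.
apply/forallP=> x; apply/forallP=> y; apply/implyP=> xy.
by have /forallP/(_ (inr x))/forallP/(_ (inr y))/implyP := mixed_resolvingT; apply.
Qed.

Lemma metric_basis_exists : exists S : {set G}, metric_basis S.
Proof.
have [] := @bigminnP _ (@resolving G) (fun S => #|S|) #|G| setT resolvingT.
  exact: max_card.
by case=> S rS dS _; exists S; rewrite /metric_basis rS dS eqxx.
Qed.

End FullSet.

(* Main.v *)
Require Import Defs.
From mathcomp Require Import all_boot.
From mathcomp Require Import zify.

(** Distances in [subdiv G] to an original vertex [v] are [2 d(u, v)] from an
   original vertex [u], [2 d(e, v) + 1] from [v_e], and [d(u, v) + d(e, v)] from
   the edge joining [u] to [v_e].  Since [d(u, v)] is [d(e, v)] or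
   [d(e, v) + 1], parity shows that the vertices of a mixed resolving set of [G]
   still resolve all elements of [subdiv G].  For the second part, a subdivision
   vertex [v_g] resolves a pair only if one of its two neighbours, the ends of
   [g], does; hence [phi_set X] resolves everything that [X] resolves. *)

Set Implicit Arguments.
Unset Strict Implicit.
Unset Printing Implicit Defensive.

(** * Distances from vertices and from edges *)

Section Distances.

Variable G : sgraph.
Implicit Types (x y z : G) (S : {set G}).

(** The third hypothesis yields a walk from [x] to [z] of length [f x], and the second shows that no
    walk is shorter. A guessed formula for the distance can thus be verified locally, and
    connectedness comes with it. *)
Lemma dist_unique z (f : G -> nat) :
    f z = 0 ->
    (forall x y, adj x y -> f x <= (f y).+1) ->
    (forall x, x != z -> exists2 y, adj x y & f x = (f y).+1) ->
  forall x, connect (@adj G) x z /\ dist x z = f x.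
Proof.
move=> fz flip fstep.
have walk n x : f x = n ->
    exists p, [/\ path (@adj G) x p, last x p = z & size p = n].
  elim: n x => [|n IHn] x fx.
    exists [::]; split=> //=; apply/eqP; apply: contraT => /fstep[y _].
    by rewrite fx.
  have [xz|/fstep[y xy]] := eqVneq x z; first by rewrite xz fz in fx.
  rewrite fx => -[/esym/IHn[p [pp lp sp]]].
  by exists (y :: p); rewrite /= xy sp.
have lb p x : path (@adj G) x p -> last x p = z -> f x <= size p.
  elim: p x => [|y p IHp] x /=; first by move=> _ ->; rewrite fz.
  by move=> /andP[/flip fxy pp] /(IHp _ pp) fy; apply: leq_trans fxy _.
move=> x; have [p [pp lp sp]] := walk _ x erefl.
have xz : connect (@adj G) x z by apply/connectP; exists p.
split=> //; have [[q [pq lq sq]] /(_ p pp lp)] := distP xz.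
by have := lb q x pq lq; rewrite sq sp => h1 h2; apply/eqP; rewrite eqn_leq h1 h2.
Qed.

(** This makes the default [#|G|] in [edist] harmless: the minimum is attained at an end of the
    edge. *)
Lemma dist_le_card x y : dist x y <= #|G|.
Proof. by rewrite (leq_trans (find_size _ _)) ?size_iota. Qed.

Lemma dist_refl x : dist x x = 0.
Proof. by apply/eqP; rewrite dist_eq0. Qed.

Lemma edge_ends (e : edge G) : exists x y, adj x y /\ val e = [set x; y].
Proof.
by case: e => e /=; rewrite inE => /existsP[x /existsP[y /andP[xy /eqP->]]]; exists x, y.
Qed.

Lemma pair_in_edges x y : adj x y -> [set x; y] \in edges G.
Proof.
by move=> xy; rewrite inE; apply/existsP; exists x; apply/existsP; exists y; rewrite xy /=.
Qed.

Lemma edge_adj (e : edge G) x y : x \in val e -> y \in val e -> x != y -> adj x y.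
Proof.
have [a [b [ab ->]]] := edge_ends e.
by rewrite !inE => /orP[]/eqP-> /orP[]/eqP->; rewrite ?eqxx // adj_sym ab.
Qed.

(** The ends of [e] are distinct, so [e] has two elements, while [f] has at most two. *)
Lemma edge_val_sub (e f : edge G) : val e \subset val f -> e = f.
Proof.
have [a [b [ab ve]]] := edge_ends e; have [c [d [cd vf]]] := edge_ends f.
move=> ef; apply/val_inj/eqP; rewrite eqEcard ef ve vf !cards2 /=.
have -> : a != b by apply: contraTneq ab => ->; rewrite adj_irrefl.
by case: (c != d).
Qed.

Lemma edist_le (e : edge G) x v : x \in val e -> edist e v <= dist x v.
Proof.
move=> xe; have [_] := @bigminnP _ (mem (val e)) (fun w => dist w v) _ x xe (dist_le_card x v).
exact.
Qed.

Lemma edist_attained (e : edge G) v : exists2 x, x \in val e & edist e v = dist x v.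
Proof.
have [x [y [_ ve]]] := edge_ends e; have xe : x \in val e by rewrite ve !inE eqxx.
have [[w we dw] _] := @bigminnP _ (mem (val e)) (fun w => dist w v) _ x xe (dist_le_card x v).
by exists w.
Qed.

Lemma edist_pair (e : edge G) x y v :
  val e = [set x; y] -> edist e v = minn (dist x v) (dist y v).
Proof.
move=> ve; have [w] := edist_attained e v; rewrite ve !inE => we dw.
have := @edist_le e x v; have := @edist_le e y v.
rewrite ve !inE !eqxx orbT => /(_ isT) hy /(_ isT) hx.
by case/orP: we dw => /eqP-> dw; lia.
Qed.

(** * Resolving sets and the three dimensions *)

Lemma mixed_resolvingP S :
  reflect (forall a b, (forall v, v \in S -> eltdist a v = eltdist b v) -> a = b)
          (mixed_resolving S).
Proof.
apply: (iffP 'forall_forallP) => [h a b same|h a b].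
  apply/eqP; apply: contraT => /(implyP (h a b))/existsP[v /andP[vS]].
  by rewrite /resolves same ?eqxx.
apply/implyP; apply: contraR => /existsPn same; apply/eqP/h => v vS.
by apply/eqP; have := same v; rewrite vS negbK.
Qed.

Lemma mdim_le S : mixed_resolving S -> mdim G <= #|S|.
Proof. by move=> rS; have [_] := @bigminnP _ _ (fun T : {set G} => #|T|) _ S rS (max_card (mem S)); apply. Qed.

Lemma mdim_attained : exists2 S : {set G}, mixed_resolving S & #|S| = mdim G.
Proof.
by have [] := @bigminnP _ _ (fun T : {set G} => #|T|) _ _ (mixed_resolvingT G)
  (max_card (mem setT)).
Qed.

Lemma dim_le S : resolving S -> dim G <= #|S|.
Proof. by move=> rS; have [_] := @bigminnP _ _ (fun T : {set G} => #|T|) _ S rS (max_card (mem S)); apply. Qed.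

Lemma edim_le S : edge_resolving S -> edim G <= #|S|.
Proof. by move=> rS; have [_] := @bigminnP _ _ (fun T : {set G} => #|T|) _ S rS (max_card (mem S)); apply. Qed.

(** * Distances in a connected graph *)

Hypothesis cG : connected G.

Lemma dist_adj x y z : adj x y -> dist x z <= (dist y z).+1.
Proof.
move=> xy; have [[p [pp lp <-]] _] := distP (cG.2 y z).
by have [_ /(_ (y :: p))] := distP (cG.2 x z); apply; rewrite //= xy.
Qed.

Lemma dist_step x z : x != z -> exists2 y, adj x y & dist x z = (dist y z).+1.
Proof.
have [[[|y p] [/= pp lp sp]] _] := distP (cG.2 x z); first by rewrite lp eqxx.
move=> _; case/andP: pp => xy pp; exists y => //.
have := dist_adj z xy; have [_ /(_ p pp lp)] := distP (cG.2 y z); lia.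
Qed.

Lemma dist_sym x y : dist x y = dist y x.
Proof.
suff le (a b : G) : dist a b <= dist b a by apply/eqP; rewrite eqn_leq !le.
have [[p [pp lp <-]] _] := distP (cG.2 b a).
have [_ /(_ (rev (belast b p)))] := distP (cG.2 a b).
rewrite size_rev size_belast; apply.
  rewrite -lp rev_path; apply: sub_path pp => c d /=.
  by rewrite adj_sym.
by rewrite -lp; case: p {pp lp} => //= c p; rewrite rev_cons last_rcons.
Qed.

(** A shortest walk from [s] to another vertex begins with a step to a neighbour [w], and [x] and
    [y] are equally far from [w]. Contrapositively, if [s] resolves two vertices other than itself,
    so does one of its neighbours. *)
Lemma dist_from_neighbours s x y :
    x != s -> y != s -> (forall w, adj s w -> dist x w = dist y w) ->
  dist x s = dist y s.
Proof.
suff le (a b : G) : a != s -> (forall w, adj s w -> dist a w = dist b w) ->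
    dist b s <= dist a s.
  by move=> xs ys h; apply/eqP; rewrite eqn_leq !le // => w /h.
rewrite eq_sym => /dist_step[w sw da] h.
by rewrite !(dist_sym _ s) da (dist_sym w) h // (dist_sym b) dist_adj.
Qed.

(** An end of [e] attains the minimum or is adjacent to the end that does. With [edist_le], this
    leaves only the values [edist e v] and [(edist e v).+1]. *)
Lemma dist_end_le (e : edge G) x v : x \in val e -> dist x v <= (edist e v).+1.
Proof.
move=> xe; have [w we ->] := edist_attained e v.
by have [->|xw] := eqVneq x w; [apply: leqnSn | apply/dist_adj/(edge_adj xe we)].
Qed.

End Distances.

(** * Distances in the subdivision graph *)

Section Subdivision.

Variable G : sgraph.
Hypothesis cG : connected G.
Local Notation SG := (subdiv G).

(** The right-hand side satisfies the criterion [dist_unique]: from [v_e] one steps to an end of [e]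
    nearest to [v], from [u] to the first edge of a shortest walk to [v]. *)
Lemma dist_to_vertex (v : G) (a : SG) :
  connect (@adj SG) a (inl v) /\
  dist a (inl v) = match a with inl u => (dist u v).*2 | inr e => (edist e v).*2.+1 end.
Proof.
move: a; apply: dist_unique; first by rewrite dist_refl.
  move=> [u|e] [w|f] //= h.
    by have := dist_end_le cG v h; lia.
  by have := edist_le v h; lia.
move=> [u|e] ne.
  have uv : u != v by apply: contraNneq ne => ->.
  have [w uw duv] := dist_step cG uv.
  (* As [w] is one step closer to [v] than [u], it attains [edist e v], and the formula drops by
     exactly one from [u] to [v_e]. *)
  pose e : edge G := Sub [set u; w] (pair_in_edges uw).
  have ue : u \in val e by rewrite /= !inE eqxx.
  have we : w \in val e by rewrite /= !inE eqxx orbT.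
  exists (inr e : SG) => //=.
  by have := dist_end_le cG v ue; have := edist_le v we; lia.
by have [w we ->] := edist_attained e v; exists (inl w : SG).
Qed.

Lemma subdiv_connected : connected SG.
Proof.
have [/card_gt0P[v _] _] := cG; split; first by apply/card_gt0P; exists (inl v : SG).
move=> a b; apply: connect_trans (dist_to_vertex v a).1 _.
rewrite (sym_connect_sym (@adj_sym SG)); exact: (dist_to_vertex v b).1.
Qed.

Lemma dist_subdiv_vertex (u v : G) : dist (inl u : SG) (inl v) = (dist u v).*2.
Proof. exact: (dist_to_vertex v (inl u)).2. Qed.

Lemma dist_subdiv_edge (e : edge G) (v : G) :
  dist (inr e : SG) (inl v) = (edist e v).*2.+1.
Proof. exact: (dist_to_vertex v (inr e)).2. Qed.

Lemma subdiv_edgeP (h : edge SG) :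
  exists (u : G) (e : edge G), u \in val e /\ val h = [set (inl u : SG); (inr e : SG)].
Proof.
have [[u|e] [[w|f] [//= ab ->]]] := edge_ends h; first by exists u, f.
by exists w, e; rewrite setUC.
Qed.

(** The minimum of [2 d(u, v)] and [2 d(e, v) + 1] is the first if [d(u, v) = d(e, v)] and the
    second if [d(u, v) = d(e, v) + 1]; in both cases it is the sum. *)
Lemma edist_subdiv (h : edge SG) (u : G) (e : edge G) v : u \in val e ->
  val h = [set (inl u : SG); (inr e : SG)] -> edist h (inl v : SG) = dist u v + edist e v.
Proof.
move=> ue /edist_pair->; rewrite dist_subdiv_vertex dist_subdiv_edge.
by have := edist_le v ue; have := dist_end_le cG v ue; lia.
Qed.

(** * Mixed resolving sets of the subdivision graph *)

Lemma subdiv_mixed_resolving (S : {set G}) :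
  mixed_resolving S -> mixed_resolving [set (inl v : SG) | v in S].
Proof.
move=> /mixed_resolvingP rS.
have vv x y : (forall v, v \in S -> dist x v = dist y v) -> x = y.
  by move=> h; case: (rS (inl x) (inl y) h).
have ve x e : ~ (forall v, v \in S -> dist x v = edist e v).
  by move=> h; have := rS (inl x) (inr e) h.
have ee e f : (forall v, v \in S -> edist e v = edist f v) -> e = f.
  by move=> h; case: (rS (inr e) (inr f) h).
have vertex_subdivision w f :
    ~ (forall v, v \in S -> dist (inl w : SG) (inl v) = dist (inr f : SG) (inl v)).
  move=> h; apply: (ve w f) => v /h.
  by rewrite dist_subdiv_vertex dist_subdiv_edge; lia.
(* An even value of [d(u, v) + d(e, v)] forces [d(u, v) = d(e, v)], so [u] and [e] would not be
   resolved. *)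
have vertex_half w (h : edge SG) :
    ~ (forall v, v \in S -> dist (inl w : SG) (inl v) = edist h (inl v : SG)).
  have [u [e [ue vh]]] := subdiv_edgeP h.
  move=> same; apply: (ve u e) => v /same.
  rewrite (edist_subdiv v ue vh) dist_subdiv_vertex.
  by have := edist_le v ue; have := dist_end_le cG v ue; lia.
have edge_half f (h : edge SG) :
    ~ (forall v, v \in S -> dist (inr f : SG) (inl v) = edist h (inl v : SG)).
  have [u [e [ue vh]]] := subdiv_edgeP h.
  move=> same.
  (* Then the other end [w] of [e] realises [d(e, v)] for every [v] in [S], so
     [w] and [e] are not resolved. *)
  have far v : v \in S -> dist u v = (edist e v).+1.
    move=> /same; rewrite (edist_subdiv v ue vh) dist_subdiv_edge.
    by have := edist_le v ue; have := dist_end_le cG v ue; lia.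
  have [w we wu] : exists2 w, w \in val e & w != u.
    have [a [b [ab e_ab]]] := edge_ends e.
    have [au|au] := eqVneq a u; last by exists a; rewrite ?e_ab ?inE ?eqxx.
    exists b; first by rewrite e_ab !inE eqxx orbT.
    by apply: contraTneq ab => ->; rewrite au adj_irrefl.
  apply: (ve w e) => v vS; have [z ze dz] := edist_attained e v.
  have [zw|zw] := eqVneq z w; first by rewrite dz zw.
  (* The edge [e] has only the ends [u] and [w]; but [u] is never nearest, by [far]. *)
  have zu : z = u.
    apply/eqP; apply: contraT => zu; have [a [b [_ e_ab]]] := edge_ends e.
    move: ue we ze zw zu wu; rewrite e_ab !inE.
    by do 3![case/orP=> /eqP->]; rewrite ?eqxx.
  by have := far v vS; rewrite dz zu; lia.
apply/mixed_resolvingP=> a b same.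
have {}same v : v \in S -> eltdist a (inl v : SG) = eltdist b (inl v : SG).
  by move=> vS; apply/same/imset_f.
case: a b same => [[x|e]|h] [[y|f]|k] /= same.
- congr (inl (inl _)); apply: vv => v /same.
  by rewrite !dist_subdiv_vertex; lia.
- by case: (vertex_subdivision x f).
- by case: (vertex_half x k).
- by case: (vertex_subdivision y e) => v /same.
- congr (inl (inr _)); apply: ee => v /same.
  by rewrite !dist_subdiv_edge; lia.
- by case: (edge_half e k).
- by case: (vertex_half y h) => v /same.
- by case: (edge_half f h) => v /same.
have [u [e [ue vh]]] := subdiv_edgeP h; have [w [f [wf vk]]] := subdiv_edgeP k.
have {}same v : v \in S -> dist u v + edist e v = dist w v + edist f v.
  by move=> /same; rewrite (edist_subdiv v ue vh) (edist_subdiv v wf vk).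
(* Half of [d(u, v) + d(e, v)], rounded down, is [d(e, v)]. Once the edges agree, so do the
   distances from [u] and [w]. *)
have ef : e = f.
  apply: ee => v /same.
  have := edist_le v ue; have := dist_end_le cG v ue.
  by have := edist_le v wf; have := dist_end_le cG v wf; lia.
have uw : u = w by apply: vv => v /same; rewrite ef; lia.
by congr inr; apply: val_inj; rewrite vh vk ef uw.
Qed.

(** * Replacing subdivision vertices by their neighbours *)

Lemma phi_set_vertex (X : {set SG}) u : (inl u : SG) \in X -> u \in phi_set X.
Proof. by move=> uX; rewrite inE uX. Qed.

Lemma phi_set_edge (X : {set SG}) e u :
  (inr e : SG) \in X -> u \in val e -> u \in phi_set X.
Proof.
by move=> eX ue; rewrite inE; apply/orP; right; apply/existsP; exists e; rewrite eX.
Qed.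

(** Restricting to pairs of the same kind treats vertices and edges of [G] at once. It also ensures
    that if one of [a], [b] is the resolving vertex [v_g], the other is a subdivision vertex too. *)
Lemma phi_set_resolves (X : {set SG}) (a b : SG) :
    resolving X -> is_inl a = is_inl b ->
    (forall u, u \in phi_set X -> dist a (inl u) = dist b (inl u)) ->
  a = b.
Proof.
move=> rX ab_inl same; apply/eqP; apply: contraT => ab.
have /existsP[s /andP[sX]] : [exists v in X, resolves v (inl a) (inl b)].
  by move: rX => /'forall_forallP/(_ a b)/implyP; apply.
rewrite /resolves /= => /eqP[].
case: s sX => [u /phi_set_vertex/same //|g gX].
have nbr w : adj (inr g : SG) w -> dist a w = dist b w.
  by case: w => // w wg; apply: same; apply: phi_set_edge gX wg.
(* This excludes the case that [a] or [b] is the resolving vertex [v_g] itself. *)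
have key f :
    (forall w, w \in val g ->
       dist (inr g : SG) (inl w) = dist (inr f : SG) (inl w)) -> g = f.
  move=> h; apply/edge_val_sub/subsetP => w wg.
  (* An end [w] of [g] is at distance 1 from [v_g], hence from [v_f], so it is an end of [f]. *)
  have := h w wg; rewrite !dist_subdiv_edge => -[/double_inj].
  by move=> h0; rewrite -edist_eq0 -h0 edist_eq0.
have [ag|ag] := eqVneq a (inr g).
  case/eqP: ab; case: b ab_inl nbr {same} => [|f]; rewrite ag // => _ h.
  by congr inr; apply: key => w wg; apply: h.
have [bg|bg] := eqVneq b (inr g).
  case/eqP: ab; case: a ab_inl nbr {same ag} => [|f]; rewrite bg // => _ h.
  by congr inr; apply/esym/key => w wg; rewrite h.
exact (dist_from_neighbours subdiv_connected ag bg nbr).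
Qed.

Lemma phi_set_resolving (X : {set SG}) : resolving X -> resolving (phi_set X).
Proof.
move=> rX; apply/'forall_forallP=> x y; apply/implyP; apply: contraR => /existsPn h.
suff [->] : (inl x : SG) = inl y by [].
apply: (@phi_set_resolves X (inl x) (inl y) rX erefl) => u uX.
rewrite !dist_subdiv_vertex; congr double.
by apply/eqP; have := h u; rewrite uX negbK.
Qed.

Lemma phi_set_edge_resolving (X : {set SG}) :
  resolving X -> edge_resolving (phi_set X).
Proof.
move=> rX; apply/'forall_forallP=> e f; apply/implyP; apply: contraR => /existsPn h.
suff [->] : (inr e : SG) = inr f by [].
apply: (@phi_set_resolves X (inr e) (inr f) rX erefl) => u uX.
rewrite !dist_subdiv_edge; congr (_.*2.+1).
by apply/eqP; have := h u; rewrite uX negbK.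
Qed.

End Subdivision.

Theorem theorem3p1 (G : sgraph) (hG : connected G) :
  mdim (subdiv G) <= mdim G /\ maxn (dim G) (edim G) <= phi G.
Proof.
split.
  have [S rS <-] := mdim_attained G.
  rewrite -(card_imset _ (@inl_inj _ (edge G))).
  exact/mdim_le/subdiv_mixed_resolving.
have [X bX] := metric_basis_exists (subdiv G).
(* The default [#|G|] bounds the size of [phi_set X], so [phi] is attained at a metric basis [Y]. *)
have [[Y /andP[rY _] phiY] _] := @bigminnP _ (@metric_basis (subdiv G))
  (fun X => #|phi_set X|) #|G| X bX (max_card (mem (phi_set X))).
rewrite /phi -phiY geq_max; apply/andP; split; first exact/dim_le/phi_set_resolving.
exact/edim_le/phi_set_edge_resolving.
Qed.
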